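(* Let $\mathfrak{F}$ be a surface in $E^3$ of class $C^r$, $r\ge 4$, without parabolic points, which is not a canal surface and not a moulding surface, with principal curvatures $k_1,k_2$ and geodesic curvatures $q_1,q_2$ of the lines of curvature. Consider the two nets on $\mathfrak{F}$ corresponding to the lines of curvature of the central surfaces $\mathfrak{F}^{(1)}$ and $\mathfrak{F}^{(2)}$, respectively, namely $$q_1\nabla_1k_1\,\omega_1^2+\bigl[k_1^2(k_1-k_2)+q_2\nabla_1k_1+q_1\nabla_2k_1\bigr]\omega_1\omega_2+q_2\nabla_2k_1\,\omega_2^2=0$$ and $$q_1\nabla_1k_2\,\omega_1^2+\bigl[k_2^2(k_1-k_2)+q_2\nabla_1k_2+q_1\nabla_2k_2\bigr]\omega_1\omega_2+q_2\nabla_2k_2\,\omega_2^2=0 .$$ The spherical images of these nets are both orthogonal if and only if $\mathfrak{F}$ is a W-surface satisfying $$\frac1{k_1}+\frac1{k_2}=\text{const.}$$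
   Context: Setting. $\bar x(u,v)$ is a parametric representation of $\mathfrak{F}$ over a connected domain. $\{\bar e_1,\bar e_2,\bar e_3\}$ is the orthonormal moving frame with $\bar e_1,\bar e_2$ the principal directions, $\bar e_3$ the unit normal, $\det(\bar e_1,\bar e_2,\bar e_3)=1$. The linear differential forms $\omega_1,\omega_2,\omega_{ij}$ are defined by $d\bar x=\omega_1\bar e_1+\omega_2\bar e_2$, $d\bar e_i=\sum_{j}\omega_{ij}\bar e_j$ ($\omega_{ij}=-\omega_{ji}$), and $\omega_{31}=-k_1\omega_1$, $\omega_{32}=-k_2\omega_2$, $\omega_{12}=q_1\omega_1+q_2\omega_2$, where $k_1,k_2$ are the principal curvatures and $q_1,q_2$ the geodesic curvatures of the lines of curvature. For a function $f$, the Pfaffian derivatives $\nabla_1 f,\nabla_2 f$ are defined by $df=\nabla_1 f\,\omega_1+\nabla_2 f\,\omega_2$. Standing assumptions. $\mathfrak{F}$ has no parabolic points: $k_1k_2\neq 0$ everywhere. $\mathfrak{F}$ is not a canal surface, so that the central surfaces do not degenerate into curves; this is used in the form $k_1\neq k_2$, $\nabla_1k_1\neq 0$ and $\nabla_2k_2\neq0$ everywhere. Moulding surfaces. A moulding surface is a surface generated by the orthogonal trajectories of a one-parameter family of planes; this is the case where $q_1$ vanishes identically or $q_2$ vanishes identically. Central surfaces. $\mathfrak{F}^{(i)}$, $i=1,2$, is the surface parametrized by $\bar y^{(i)}=\bar x+\frac{1}{k_i}\bar e_3$; points of $\mathfrak{F}$ and $\mathfrak{F}^{(i)}$ with the same parameters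 $(u,v)$ correspond to each other. Nets. A net on $\mathfrak{F}$ is given by a quadratic differential equation in $\omega_1,\omega_2$; its spherical image is its image under the Gauss map $\bar e_3$ to the unit sphere, obtained by substituting $\omega_1=-\omega_{31}/k_1$, $\omega_2=-\omega_{32}/k_2$. The first fundamental form of the spherical image is $\omega_{31}^2+\omega_{32}^2$, and a spherical net $A\,\omega_{31}^2+2B\,\omega_{31}\omega_{32}+C\,\omega_{32}^2=0$ is orthogonal if its two directions are orthogonal with respect to this form, i.e. $A+C=0$ identically. A Weingarten surface (W-surface) is a surface for which there is a functional relation between $k_1$ and $k_2$. *)

(* Defs.v *)
From Stdlib Require Export Reals.
From Coquelicot Require Export Coquelicot.

Open Scope R_scope.

Notation E3 := (R * R * R)%type.

Definition c1 (a : E3) : R := fst (fst a).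
Definition c2 (a : E3) : R := snd (fst a).
Definition c3 (a : E3) : R := snd a.

Definition dot (a b : E3) : R := c1 a * c1 b + c2 a * c2 b + c3 a * c3 b.

Definition cross (a b : E3) : E3 :=
  (c2 a * c3 b - c3 a * c2 b,
   c3 a * c1 b - c1 a * c3 b,
   c1 a * c2 b - c2 a * c1 b).

Definition det3 (a b c : E3) : R := dot (cross a b) c.

Definition connected (D : R * R -> Prop) : Prop :=
  forall U V : R * R -> Prop, open U -> open V ->
    (forall p, D p -> U p \/ V p) ->
    (exists p, D p /\ U p) -> (exists p, D p /\ V p) ->
    exists p, D p /\ U p /\ V p.

(* [ex_diff_n f n u v]: the partial derivatives of order at most [n] exist and
   are continuous at (u,v); on an open set this is the class C^n. *)
Definition class_C (D : R * R -> Prop) (n : nat) (f : R -> R -> R) : Prop :=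
  forall u v, D (u, v) -> ex_diff_n f n u v.

Definition class_C3 (D : R * R -> Prop) (n : nat) (F : R -> R -> E3) : Prop :=
  class_C D n (fun u v => c1 (F u v)) /\
  class_C D n (fun u v => c2 (F u v)) /\
  class_C D n (fun u v => c3 (F u v)).

(* The differentials df and dF at (u,v), evaluated at the tangent vector
   t = (du,dv) of the parameter domain. *)
Definition diff (f : R -> R -> R) (u v : R) (t : R * R) : R :=
  Derive (fun s => f s v) u * fst t + Derive (fun s => f u s) v * snd t.

Definition diff3 (F : R -> R -> E3) (u v : R) (t : R * R) : E3 :=
  (diff (fun a b => c1 (F a b)) u v t,
   diff (fun a b => c2 (F a b)) u v t,
   diff (fun a b => c3 (F a b)) u v t).

Definition normal_vector (x : R -> R -> E3) (u v : R) : E3 :=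
  cross (diff3 x u v (1, 0)) (diff3 x u v (0, 1)).

Definition regular_at (x : R -> R -> E3) (u v : R) : Prop :=
  normal_vector x u v <> (0, 0, 0).

Definition unit_normal (x : R -> R -> E3) (u v : R) : E3 :=
  let n := normal_vector x u v in scal (/ sqrt (dot n n)) n.

(* Rodrigues' formula dn = - k dx along t. *)
Definition curvature_direction (x : R -> R -> E3) (u v : R) (t : R * R) : Prop :=
  regular_at x u v /\
  exists k : R, diff3 (unit_normal x) u v t = scal (- k) (diff3 x u v t).

Record surface (D : R * R -> Prop) (r : nat) (x : R -> R -> E3) : Prop := {
  surface_open : open D;
  surface_connected : connected D;
  surface_class : class_C3 D r x;
  surface_regular : forall u v, D (u, v) -> regular_at x u v
}.

(* omega x e_i is the form omega_i = <dx, e_i>, and omega e_i e_j is the form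
   omega_ij = <de_i, e_j>. *)
Definition omega (F e : R -> R -> E3) (u v : R) (t : R * R) : R :=
  dot (diff3 F u v t) (e u v).

(* The equations for omega_31 and omega_32 are Rodrigues' formulas: they say
   that e1, e2 are principal directions with principal curvatures k1, k2.
   The frame is C^(r-2), the regularity of the principal directions of a
   surface of class C^r away from its umbilics. *)
Record principal_frame (D : R * R -> Prop) (r : nat) (x : R -> R -> E3)
    (e1 e2 e3 : R -> R -> E3) (k1 k2 q1 q2 : R -> R -> R) : Prop := {
  frame_class : class_C3 D (r - 2) e1 /\ class_C3 D (r - 2) e2 /\
                class_C3 D (r - 2) e3;
  frame_unit : forall u v, D (u, v) ->
    dot (e1 u v) (e1 u v) = 1 /\ dot (e2 u v) (e2 u v) = 1 /\
    dot (e3 u v) (e3 u v) = 1;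
  frame_orthogonal : forall u v, D (u, v) ->
    dot (e1 u v) (e2 u v) = 0 /\ dot (e1 u v) (e3 u v) = 0 /\
    dot (e2 u v) (e3 u v) = 0;
  frame_det : forall u v, D (u, v) -> det3 (e1 u v) (e2 u v) (e3 u v) = 1;
  frame_dx : forall u v t, D (u, v) ->
    diff3 x u v t =
    plus (scal (omega x e1 u v t) (e1 u v)) (scal (omega x e2 u v t) (e2 u v));
  frame_omega31 : forall u v t, D (u, v) ->
    omega e3 e1 u v t = - k1 u v * omega x e1 u v t;
  frame_omega32 : forall u v t, D (u, v) ->
    omega e3 e2 u v t = - k2 u v * omega x e2 u v t;
  frame_omega12 : forall u v t, D (u, v) ->
    omega e1 e2 u v t = q1 u v * omega x e1 u v t + q2 u v * omega x e2 u v t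
}.

(* g1, g2 are the Pfaffian derivatives of f: df = g1 omega_1 + g2 omega_2. *)
Definition pfaffian (D : R * R -> Prop) (x e1 e2 : R -> R -> E3)
    (f g1 g2 : R -> R -> R) : Prop :=
  forall u v t, D (u, v) ->
    diff f u v t = g1 u v * omega x e1 u v t + g2 u v * omega x e2 u v t.

Definition no_parabolic_points (D : R * R -> Prop) (k1 k2 : R -> R -> R) : Prop :=
  forall u v, D (u, v) -> k1 u v * k2 u v <> 0.

(* Not a canal surface, in the form: k1 <> k2, nabla_1 k1 <> 0 and
   nabla_2 k2 <> 0 everywhere. *)
Definition not_canal (D : R * R -> Prop) (k1 k2 d1k1 d2k2 : R -> R -> R) : Prop :=
  forall u v, D (u, v) -> k1 u v <> k2 u v /\ d1k1 u v <> 0 /\ d2k2 u v <> 0.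

Definition moulding (D : R * R -> Prop) (q1 q2 : R -> R -> R) : Prop :=
  (forall u v, D (u, v) -> q1 u v = 0) \/ (forall u v, D (u, v) -> q2 u v = 0).

Definition central_surface (x e3 : R -> R -> E3) (k : R -> R -> R)
    (u v : R) : E3 :=
  plus (x u v) (scal (1 / k u v) (e3 u v)).

(* The net  net_A s1^2 + net_B s1 s2 + net_C s2^2 = 0.  On the surface s1, s2
   stand for omega_1, omega_2, on the unit sphere for omega_31, omega_32.  The
   middle coefficient is not halved. *)
Record net : Type := Net {
  net_A : R -> R -> R;
  net_B : R -> R -> R;
  net_C : R -> R -> R
}.

Definition on_net (N : net) (u v s1 s2 : R) : Prop :=
  net_A N u v * s1 ^ 2 + net_B N u v * (s1 * s2) + net_C N u v * s2 ^ 2 = 0.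

Definition central_net (k1 k2 q1 q2 k d1k d2k : R -> R -> R) : net :=
  Net (fun u v => q1 u v * d1k u v)
      (fun u v => k u v ^ 2 * (k1 u v - k2 u v)
                  + q2 u v * d1k u v + q1 u v * d2k u v)
      (fun u v => q2 u v * d2k u v).

Definition net_of_curvature_lines (D : R * R -> Prop) (x e1 e2 : R -> R -> E3)
    (y : R -> R -> E3) (N : net) : Prop :=
  forall u v t, D (u, v) ->
    (curvature_direction y u v t <->
     on_net N u v (omega x e1 u v t) (omega x e2 u v t)).

(* Substitution of omega_1 = - omega_31 / k1 and omega_2 = - omega_32 / k2. *)
Definition spherical_image (k1 k2 : R -> R -> R) (N : net) : net :=
  Net (fun u v => net_A N u v * (- 1 / k1 u v) ^ 2)
      (fun u v => net_B N u v * ((- 1 / k1 u v) * (- 1 / k2 u v)))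
      (fun u v => net_C N u v * (- 1 / k2 u v) ^ 2).

(* Orthogonality with respect to omega_31^2 + omega_32^2. *)
Definition orthogonal_net (D : R * R -> Prop) (N : net) : Prop :=
  forall u v, D (u, v) -> net_A N u v + net_C N u v = 0.

(* The functional relation Phi(k1,k2) = 0 is required to be C^1 with
   non-vanishing gradient along (k1,k2), which excludes trivial relations. *)
Definition W_surface (D : R * R -> Prop) (k1 k2 : R -> R -> R) : Prop :=
  exists Phi : R -> R -> R,
    (forall a b, ex_diff_n Phi 1 a b) /\
    forall u v, D (u, v) ->
      Phi (k1 u v) (k2 u v) = 0 /\
      (Derive (fun a => Phi a (k2 u v)) (k1 u v) <> 0 \/
       Derive (fun b => Phi (k1 u v) b) (k2 u v) <> 0).

(* Main.v *)
Require Import Defs.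
From Stdlib Require Import Lra Lia Classical.

(* Along F^(1) one has dy = (1 - k2/k1) omega_2 e2 + d(1/k1) e3, so its normal is
   e1 up to sign; the lines of curvature are given by the linear dependence of
   de1 and dy, which is the first net.  The second net is the first one for the
   frame (e2, -e1, e3).

   By the Codazzi equations nabla_2 k1 = q1 (k1 - k2) and
   nabla_1 k2 = q2 (k1 - k2), the two orthogonality conditions read
   q1 nabla_1 S = 0 and q2 nabla_2 S = 0 with S = 1/k1 + 1/k2.  A zero of q1 is
   then a zero of q2 and vice versa, because nabla_1 k1 and nabla_2 k2 do not
   vanish; so D is the disjoint union of the open sets q1 <> 0 and
   nabla_1 S <> 0.  As D is connected and q1 is not identically 0, both q1 and q2
   are nowhere 0, and S is constant. *)

(** * Functions of class C^n *)

Lemma open_locally_2d (D : R * R -> Prop) (u v : R) :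
  open D -> D (u, v) -> locally_2d (fun a b => D (a, b)) u v.
Proof.
  intros oD Duv. apply locally_2d_locally.
  apply filter_imp with (2 := oD _ Duv). now intros [a b].
Qed.

Lemma locally_2d_open (D : R * R -> Prop) (u v : R) (P : R -> R -> Prop) :
  open D -> D (u, v) -> (forall a b, D (a, b) -> P a b) -> locally_2d P u v.
Proof.
  intros oD Duv H. apply locally_2d_impl with (2 := open_locally_2d D u v oD Duv).
  now apply locally_2d_forall.
Qed.

Lemma class_C_continuous D n f u v :
  class_C D n f -> D (u, v) -> continuity_2d_pt f u v.
Proof. intros H Duv. specialize (H u v Duv). now destruct n; destruct H. Qed.

Lemma class_C_le D n m f : (m <= n)%nat -> class_C D n f -> class_C D m f.
Proof. intros mn H u v Duv. apply ex_diff_n_m with (1 := mn). now apply H. Qed.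

Lemma class_C_Derive_u D n f :
  class_C D (S n) f -> class_C D n (fun u v => Derive (fun s : R => f s v) u).
Proof. intros H u v Duv. apply (H u v Duv). Qed.

Lemma class_C_Derive_v D n f :
  class_C D (S n) f -> class_C D n (fun u v => Derive (fun s : R => f u s) v).
Proof. intros H u v Duv. apply (H u v Duv). Qed.

Lemma class_C_is_derive_u D n f u v :
  class_C D (S n) f -> D (u, v) ->
  is_derive (fun s : R => f s v) u (Derive (fun s : R => f s v) u).
Proof. intros H Duv. apply Derive_correct, (H u v Duv). Qed.

Lemma class_C_is_derive_v D n f u v :
  class_C D (S n) f -> D (u, v) ->
  is_derive (fun s : R => f u s) v (Derive (fun s : R => f u s) v).
Proof. intros H Duv. apply Derive_correct, (H u v Duv). Qed.

Lemma class_C_ext D n f g :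
  open D -> (forall u v, D (u, v) -> f u v = g u v) ->
  class_C D n f -> class_C D n g.
Proof.
  intros oD E H u v Duv. apply ex_diff_n_ext_loc with (2 := H u v Duv).
  now apply (locally_2d_open D).
Qed.

(** Since [D] is open, candidate partial derivatives given only on [D] agree with [Derive] near each
    of its points. This is the induction step of the closure properties that follow. *)
Lemma class_C_S D n f fu fv :
  open D ->
  (forall u v, D (u, v) -> continuity_2d_pt f u v) ->
  (forall u v, D (u, v) -> is_derive (fun s : R => f s v) u (fu u v)) ->
  (forall u v, D (u, v) -> is_derive (fun s : R => f u s) v (fv u v)) ->
  class_C D n fu -> class_C D n fv -> class_C D (S n) f.
Proof.
  intros oD Cf Hu Hv Cu Cv u v Duv. split; [now apply Cf|].
  split; [eexists; now apply Hu|]. split; [eexists; now apply Hv|]. split.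
  - revert u v Duv. apply class_C_ext with (3 := Cu); auto.
    intros u v Duv. symmetry. now apply is_derive_unique, Hu.
  - revert u v Duv. apply class_C_ext with (3 := Cv); auto.
    intros u v Duv. symmetry. now apply is_derive_unique, Hv.
Qed.

Lemma class_C_const D n (c : R) : open D -> class_C D n (fun _ _ => c).
Proof.
  intros oD. revert c. induction n as [|n IH]; intros c.
  - intros u v _. split; [apply continuity_2d_pt_const|exact I].
  - apply class_C_S with (fun _ _ => 0) (fun _ _ => 0); auto.
    + intros u v _. apply continuity_2d_pt_const.
    + intros u v _. apply (is_derive_const (V := R_NormedModule)).
    + intros u v _. apply (is_derive_const (V := R_NormedModule)).
Qed.

Lemma class_C_plus D n f g :
  open D -> class_C D n f -> class_C D n g ->
  class_C D n (fun u v => f u v + g u v).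
Proof.
  intros oD. revert f g. induction n as [|n IH]; intros f g Hf Hg.
  - intros u v Duv. split; [|exact I].
    apply continuity_2d_pt_plus; now apply (class_C_continuous D 0).
  - apply class_C_S with
      (fun u v => Derive (fun s : R => f s v) u + Derive (fun s : R => g s v) u)
      (fun u v => Derive (fun s : R => f u s) v + Derive (fun s : R => g u s) v); auto.
    + intros u v Duv. apply continuity_2d_pt_plus; eapply class_C_continuous; eauto.
    + intros u v Duv.
      apply (is_derive_plus (fun s : R => f s v) (fun s : R => g s v));
        eapply class_C_is_derive_u; eauto.
    + intros u v Duv.
      apply (is_derive_plus (fun s : R => f u s) (fun s : R => g u s));
        eapply class_C_is_derive_v; eauto.
    + apply IH; now apply class_C_Derive_u.
    + apply IH; now apply class_C_Derive_v.
Qed.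

Lemma class_C_mult D n f g :
  open D -> class_C D n f -> class_C D n g ->
  class_C D n (fun u v => f u v * g u v).
Proof.
  intros oD. revert f g. induction n as [|n IH]; intros f g Hf Hg.
  - intros u v Duv. split; [|exact I].
    apply continuity_2d_pt_mult; now apply (class_C_continuous D 0).
  (* The product rule contains the undifferentiated factors too, so the induction hypothesis needs
     [f] and [g] themselves at order [n]. *)
  - assert (Hf' : class_C D n f) by (apply (class_C_le D (S n)); auto).
    assert (Hg' : class_C D n g) by (apply (class_C_le D (S n)); auto).
    eapply class_C_S with
      (fu := fun u v => Derive (fun s : R => f s v) u * g u v
                        + f u v * Derive (fun s : R => g s v) u)
      (fv := fun u v => Derive (fun s : R => f u s) v * g u v
                        + f u v * Derive (fun s : R => g u s) v); auto.
    + intros u v Duv. apply continuity_2d_pt_mult; eapply class_C_continuous; eauto.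
    + intros u v Duv.
      apply (is_derive_mult (fun s : R => f s v) (fun s : R => g s v));
        try (eapply class_C_is_derive_u; eauto). exact Rmult_comm.
    + intros u v Duv.
      apply (is_derive_mult (fun s : R => f u s) (fun s : R => g u s));
        try (eapply class_C_is_derive_v; eauto). exact Rmult_comm.
    + apply class_C_plus; auto; apply IH; auto; now apply class_C_Derive_u.
    + apply class_C_plus; auto; apply IH; auto; now apply class_C_Derive_v.
Qed.

Lemma class_C_opp D n f :
  open D -> class_C D n f -> class_C D n (fun u v => - f u v).
Proof.
  intros oD Hf. apply class_C_ext with (fun u v => -1 * f u v); auto.
  - intros u v _. ring.
  - apply class_C_mult; auto. now apply class_C_const.
Qed.

Lemma class_C_minus D n f g :
  open D -> class_C D n f -> class_C D n g ->
  class_C D n (fun u v => f u v - g u v).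
Proof. intros oD Hf Hg. apply class_C_plus; auto. now apply class_C_opp. Qed.

Lemma class_C_inv D n f :
  open D -> (forall u v, D (u, v) -> f u v <> 0) ->
  class_C D n f -> class_C D n (fun u v => / f u v).
Proof.
  intros oD nz. induction n as [|n IH]; intros Hf.
  - intros u v Duv. split; [|exact I].
    apply continuity_2d_pt_inv; auto. now apply (class_C_continuous D 0).
  - assert (Hi : class_C D n (fun u v => / f u v))
      by (apply IH, (class_C_le D (S n)); auto).
    (* The square of the inverse is written as a product of two inverses, so that [Hi] and closure
       under products give its class. *)
    eapply class_C_S with
      (fu := fun u v => - (Derive (fun s : R => f s v) u * (/ f u v * / f u v)))
      (fv := fun u v => - (Derive (fun s : R => f u s) v * (/ f u v * / f u v))); auto.
    + intros u v Duv. apply continuity_2d_pt_inv; auto.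
      eapply class_C_continuous; eauto.
    + intros u v Duv.
      replace (- _) with (- Derive (fun s : R => f s v) u / f u v ^ 2)
        by (field; auto).
      apply (is_derive_inv (fun s : R => f s v)); auto.
      eapply class_C_is_derive_u; eauto.
    + intros u v Duv.
      replace (- _) with (- Derive (fun s : R => f u s) v / f u v ^ 2)
        by (field; auto).
      apply (is_derive_inv (fun s : R => f u s)); auto.
      eapply class_C_is_derive_v; eauto.
    + apply class_C_opp, class_C_mult, class_C_mult; auto. now apply class_C_Derive_u.
    + apply class_C_opp, class_C_mult, class_C_mult; auto. now apply class_C_Derive_v.
Qed.

Lemma class_C_div D n f g :
  open D -> (forall u v, D (u, v) -> g u v <> 0) ->
  class_C D n f -> class_C D n g -> class_C D n (fun u v => f u v / g u v).
Proof. intros oD nz Hf Hg. apply class_C_mult; auto. now apply class_C_inv. Qed.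

(** * Differentials of functions along constant tangent vectors *)

Lemma class_C_diff D n f t :
  open D -> class_C D (S n) f -> class_C D n (fun u v => diff f u v t).
Proof.
  intros oD Hf. apply class_C_plus; auto.
  - apply class_C_mult; [auto|now apply class_C_Derive_u|now apply class_C_const].
  - apply class_C_mult; [auto|now apply class_C_Derive_v|now apply class_C_const].
Qed.

Lemma diff_ext D f g u v t :
  open D -> D (u, v) -> (forall a b, D (a, b) -> f a b = g a b) ->
  diff f u v t = diff g u v t.
Proof.
  intros oD Duv E. unfold diff. f_equal; f_equal.
  - apply Derive_ext_loc, locally_2d_1d_const_y with (P := fun a b => f a b = g a b).
    now apply (locally_2d_open D).
  - apply Derive_ext_loc, locally_2d_1d_const_x with (P := fun a b => f a b = g a b).
    now apply (locally_2d_open D).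
Qed.

Lemma diff_const c u v t : diff (fun _ _ => c) u v t = 0.
Proof. unfold diff. rewrite !Derive_const. ring. Qed.

Lemma diff_plus D f g u v t :
  class_C D 1 f -> class_C D 1 g -> D (u, v) ->
  diff (fun a b => f a b + g a b) u v t = diff f u v t + diff g u v t.
Proof.
  intros Hf Hg Duv. unfold diff.
  rewrite (Derive_plus (fun s : R => f s v) (fun s : R => g s v)),
    (Derive_plus (fun s : R => f u s) (fun s : R => g u s)).
  - ring.
  - eexists; eapply class_C_is_derive_v; eauto.
  - eexists; eapply class_C_is_derive_v; eauto.
  - eexists; eapply class_C_is_derive_u; eauto.
  - eexists; eapply class_C_is_derive_u; eauto.
Qed.

Lemma diff_mult D f g u v t :
  class_C D 1 f -> class_C D 1 g -> D (u, v) ->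
  diff (fun a b => f a b * g a b) u v t
  = diff f u v t * g u v + f u v * diff g u v t.
Proof.
  intros Hf Hg Duv. unfold diff.
  rewrite (Derive_mult (fun s : R => f s v) (fun s : R => g s v)),
    (Derive_mult (fun s : R => f u s) (fun s : R => g u s)).
  - ring.
  - eexists; eapply class_C_is_derive_v; eauto.
  - eexists; eapply class_C_is_derive_v; eauto.
  - eexists; eapply class_C_is_derive_u; eauto.
  - eexists; eapply class_C_is_derive_u; eauto.
Qed.

Lemma diff_inv D f u v t :
  class_C D 1 f -> D (u, v) -> f u v <> 0 ->
  diff (fun a b => / f a b) u v t = - diff f u v t / f u v ^ 2.
Proof.
  intros Hf Duv nz. unfold diff.
  rewrite (Derive_inv (fun s : R => f s v)), (Derive_inv (fun s : R => f u s)); auto.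
  - now field.
  - eexists; eapply class_C_is_derive_v; eauto.
  - eexists; eapply class_C_is_derive_u; eauto.
Qed.

(** Schwarz's theorem, extended bilinearly to constant vectors [s] and [t]. It plays the role of
    d(df) = 0 in the Codazzi equations. *)
Lemma diff_comm D f u v s t :
  open D -> class_C D 2 f -> D (u, v) ->
  diff (fun a b => diff f a b s) u v t = diff (fun a b => diff f a b t) u v s.
Proof.
  intros oD Hf Duv.
  pose proof (class_C_Derive_u D 1 f Hf) as Hu.
  pose proof (class_C_Derive_v D 1 f Hf) as Hv.
  assert (E : forall r w, diff (fun a b => diff f a b r) u v w
      = diff (fun a b => Derive (fun z : R => f z b) a) u v w * fst r
        + diff (fun a b => Derive (fun z : R => f a z) b) u v w * snd r).
  { intros r w. unfold diff at 2.
    rewrite (diff_plus D), !(diff_mult D), !diff_const; auto;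
      try apply class_C_mult; auto; try (now apply class_C_const).
    ring. }
  rewrite !E. unfold diff.
  assert (Sch := Schwarz f u v). cbv beta in *. rewrite Sch.
  - ring.
  - apply (locally_2d_open D); auto. intros a b Dab. repeat split.
    + eexists; eapply class_C_is_derive_u; eauto.
    + eexists; eapply class_C_is_derive_v; eauto.
    + eexists; eapply (class_C_is_derive_u D _ _ _ _ Hv); eauto.
    + eexists; eapply (class_C_is_derive_v D _ _ _ _ Hu); eauto.
  - eapply class_C_continuous with (2 := Duv). apply class_C_Derive_u, Hv.
  - eapply class_C_continuous with (2 := Duv). apply class_C_Derive_v, Hu.
Qed.

(** * Functions on a connected domain *)

Lemma locally_2d_const_of_diff_0 D f u v :
  open D -> class_C D 1 f -> (forall a b t, D (a, b) -> diff f a b t = 0) ->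
  D (u, v) -> locally_2d (fun a b => f a b = f u v) u v.
Proof.
  intros oD Hf H0 Duv.
  (* The neighbourhood is a square, so the horizontal segment from (u,b) to (a,b) and the vertical
     one from (u,v) to (u,b) stay inside [D]. The mean value theorem with derivative 0 applies on
     each. *)
  destruct (open_locally_2d D u v oD Duv) as [d Hd].
  exists d. intros a b Ha Hb.
  assert (Z : forall c, Rabs (c - 0) <= 0 -> c = 0).
  { intros c Hc. rewrite Rminus_0_r in Hc. now apply Rabs_eq_0, Rle_antisym, Rabs_pos. }
  assert (Between : forall p q z, Rmin p q <= z <= Rmax p q -> Rabs (q - p) < d ->
            Rabs (z - p) < d).
  { intros p q z. unfold Rmin, Rmax. destruct (Rle_dec p q); intros [? ?] Hpq;
    apply Rabs_lt_between in Hpq; apply Rabs_lt_between; lra. }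
  assert (dd := cond_pos d).
  assert (E1 : f a b = f u b).
  { assert (Da : forall z, Rmin u a <= z <= Rmax u a -> D (z, b)).
    { intros z Hz. apply Hd; auto. now apply Between with a. }
    destruct (MVT_gen (fun s : R => f s b) u a (fun _ => 0)) as [c [_ Hc]].
    - intros z Hz. specialize (H0 z b (1, 0) (Da z ltac:(lra))).
      unfold diff in H0; simpl in H0.
      replace 0 with (Derive (fun s : R => f s b) z) by lra.
      apply (class_C_is_derive_u D 0); auto. apply Da; lra.
    - intros z Hz. apply continuity_pt_filterlim.
      apply (ex_derive_continuous (fun s : R => f s b)). eexists.
      apply (class_C_is_derive_u D 0); auto.
    - lra. }
  assert (E2 : f u b = f u v).
  { assert (Db : forall z, Rmin v b <= z <= Rmax v b -> D (u, z)).
    { intros z Hz. apply Hd.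
      - rewrite Rminus_diag, Rabs_R0. lra.
      - now apply Between with b. }
    destruct (MVT_gen (fun s : R => f u s) v b (fun _ => 0)) as [c [_ Hc]].
    - intros z Hz. specialize (H0 u z (0, 1) (Db z ltac:(lra))).
      unfold diff in H0; simpl in H0.
      replace 0 with (Derive (fun s : R => f u s) z) by lra.
      apply (class_C_is_derive_v D 0); auto. apply Db; lra.
    - intros z Hz. apply continuity_pt_filterlim.
      apply (ex_derive_continuous (fun s : R => f u s)). eexists.
      apply (class_C_is_derive_v D 0); auto.
    - lra. }
  congruence.
Qed.

Lemma open_neq_0 D f :
  open D -> (forall u v, D (u, v) -> continuity_2d_pt f u v) ->
  open (fun p : R * R => D p /\ f (fst p) (snd p) <> 0).
Proof.
  intros oD Cf [u v] [Duv nz].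
  pose proof (locally_2d_and _ _ u v (open_locally_2d D u v oD Duv)
    (continuity_2d_pt_neq_0 f u v (Cf u v Duv) nz)) as H.
  apply locally_2d_locally in H.
  apply filter_imp with (2 := H). now intros [a b].
Qed.

(** The equivalence makes the open sets [f <> 0] and [g <> 0] disjoint and lets them cover [D];
    connectedness leaves only the one known to be nonempty. *)
Lemma connected_neq_0 D f g :
  open D -> connected D ->
  (forall u v, D (u, v) -> continuity_2d_pt f u v) ->
  (forall u v, D (u, v) -> continuity_2d_pt g u v) ->
  (forall u v, D (u, v) -> f u v = 0 <-> g u v <> 0) ->
  (exists u v, D (u, v) /\ f u v <> 0) ->
  forall u v, D (u, v) -> f u v <> 0.
Proof.
  intros oD cD Cf Cg Hfg [u0 [v0 [D0 nz0]]] u v Duv fz.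
  destruct (cD _ _ (open_neq_0 D f oD Cf) (open_neq_0 D g oD Cg))
    as [[a b] [Dab [[_ fab] [_ gab]]]].
  - intros [a b] Dab. simpl. destruct (Req_dec (f a b) 0) as [E|E]; [right|left]; auto.
    split; auto. now apply Hfg.
  - now exists (u0, v0).
  - exists (u, v). repeat split; auto. now apply Hfg.
  - now apply fab, Hfg.
Qed.

(** The level set through a fixed point is open because [f] is locally constant, and its complement
    in [D] is open because [f] is continuous. *)
Lemma connected_const_of_diff_0 D f :
  open D -> connected D -> class_C D 1 f ->
  (forall a b t, D (a, b) -> diff f a b t = 0) ->
  exists c, forall u v, D (u, v) -> f u v = c.
Proof.
  intros oD cD Hf H0.
  destruct (classic (exists p, D p)) as [[[u0 v0] D0]|ne].
  (* On an empty domain any constant will do. *)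
  2:{ exists 0. intros u v Duv. exfalso. eauto. }
  exists (f u0 v0). intros u v Duv.
  set (U := fun p : R * R => D p /\ f (fst p) (snd p) = f u0 v0).
  destruct (classic (f u v = f u0 v0)) as [E|nE]; auto. exfalso.
  assert (oU : open U).
  { intros [a b] [Dab E].
    pose proof (locally_2d_and _ _ a b (open_locally_2d D a b oD Dab)
      (locally_2d_const_of_diff_0 D f a b oD Hf H0 Dab)) as H.
    apply locally_2d_locally in H. apply filter_imp with (2 := H).
    intros [p q] [Dpq Epq]; simpl in *. split; auto. simpl. congruence. }
  destruct (cD U _ oU (open_neq_0 D (fun a b => f a b - f u0 v0) oD
    (fun a b Dab => continuity_2d_pt_minus _ _ a b (class_C_continuous D 1 f a b Hf Dab)
       (continuity_2d_pt_const a b (f u0 v0))))) as [[a b] [Dab [[_ E1] [_ E2]]]].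
  - intros [a b] Dab. unfold U. simpl.
    destruct (Req_dec (f a b) (f u0 v0)); [left|right]; split; auto; lra.
  - exists (u0, v0). now repeat split.
  - exists (u, v). repeat split; simpl; auto; lra.
  - simpl in *. lra.
Qed.

(** * Orthonormal frames *)

Definition oriented_frame (e1 e2 e3 : E3) : Prop :=
  (dot e1 e1 = 1 /\ dot e2 e2 = 1 /\ dot e3 e3 = 1) /\
  (dot e1 e2 = 0 /\ dot e1 e3 = 0 /\ dot e2 e3 = 0) /\ det3 e1 e2 e3 = 1.

Lemma dot_comm a b : dot a b = dot b a.
Proof. unfold dot; ring. Qed.

Lemma dot_plus_l (a b c : E3) : dot (plus a b) c = dot a c + dot b c.
Proof.
  change (plus a b) with (c1 a + c1 b, c2 a + c2 b, c3 a + c3 b).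
  unfold dot, c1, c2, c3; simpl; ring.
Qed.

Lemma dot_scal_l (k : R) (a b : E3) : dot (scal k a) b = k * dot a b.
Proof.
  change (scal k a) with (k * c1 a, k * c2 a, k * c3 a).
  unfold dot, c1, c2, c3; simpl; ring.
Qed.

Lemma dot_opp_l (a b : E3) : dot (opp a) b = - dot a b.
Proof.
  change (opp a) with (- c1 a, - c2 a, - c3 a).
  unfold dot, c1, c2, c3; simpl; ring.
Qed.

Lemma dot_opp_r a b : dot a (opp b) = - dot a b.
Proof. now rewrite dot_comm, dot_opp_l, dot_comm. Qed.

Lemma scal_Ropp_opp (k : R) (a : E3) : scal (- k) (opp a) = scal k a.
Proof.
  change (scal (- k) (opp a)) with (- k * - c1 a, - k * - c2 a, - k * - c3 a).
  change (scal k a) with (k * c1 a, k * c2 a, k * c3 a).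
  now rewrite !Rmult_opp_opp.
Qed.

(** Lets the cross product formula for the plane orthogonal to the third vector serve the tangent
    plane of the central surface, which is orthogonal to [e1]. *)
Lemma oriented_frame_cycle e1 e2 e3 :
  oriented_frame e1 e2 e3 -> oriented_frame e2 e3 e1.
Proof.
  intros [[? [? ?]] [[? [? ?]] Hdet]]. repeat split; auto; try now rewrite dot_comm.
  rewrite <- Hdet. unfold det3, dot, cross, c1, c2, c3; simpl; ring.
Qed.

(** A quarter turn about [e3] exchanges the two principal directions; the sign of [e1] preserves the
    orientation. *)
Lemma oriented_frame_turn e1 e2 e3 :
  oriented_frame e1 e2 e3 -> oriented_frame e2 (opp e1) e3.
Proof.
  intros [[? [? ?]] [[? [? ?]] Hdet]].
  repeat split; auto; rewrite ?dot_opp_l, ?dot_opp_r; try lra.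
  - rewrite dot_comm. lra.
  - rewrite <- Hdet. change (opp e1) with (- c1 e1, - c2 e1, - c3 e1).
    unfold det3, dot, cross, c1, c2, c3; simpl; ring.
Qed.

(** Cramer's rule: the determinant times a vector is the combination of the cross products of the
    frame whose coefficients are the scalar products, and the determinant is 1. *)
Lemma oriented_frame_eq e1 e2 e3 v w :
  oriented_frame e1 e2 e3 ->
  dot v e1 = dot w e1 -> dot v e2 = dot w e2 -> dot v e3 = dot w e3 -> v = w.
Proof.
  intros [_ [_ H]] H1 H2 H3.
  assert (E : forall z : E3, det3 e1 e2 e3 * c1 z
      = dot z e1 * c1 (cross e2 e3) + dot z e2 * c1 (cross e3 e1) + dot z e3 * c1 (cross e1 e2)
    /\ det3 e1 e2 e3 * c2 z
      = dot z e1 * c2 (cross e2 e3) + dot z e2 * c2 (cross e3 e1) + dot z e3 * c2 (cross e1 e2)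
    /\ det3 e1 e2 e3 * c3 z
      = dot z e1 * c3 (cross e2 e3) + dot z e2 * c3 (cross e3 e1) + dot z e3 * c3 (cross e1 e2)).
  { intros z. unfold det3, dot, cross, c1, c2, c3; simpl. repeat split; ring. }
  destruct (E v) as [V1 [V2 V3]], (E w) as [W1 [W2 W3]].
  rewrite H in *.
  destruct v as [[v1 v2] v3], w as [[w1 w2] w3]. unfold c1, c2, c3 in *; simpl in *.
  rewrite H1, H2, H3 in *. f_equal; [f_equal|]; lra.
Qed.

Lemma oriented_frame_dot e1 e2 e3 v w :
  oriented_frame e1 e2 e3 ->
  dot v w = dot v e1 * dot w e1 + dot v e2 * dot w e2 + dot v e3 * dot w e3.
Proof.
  intros F.
  assert (E : v = plus (scal (dot v e1) e1) (plus (scal (dot v e2) e2) (scal (dot v e3) e3))).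
  { pose proof F as [[A1 [A2 A3]] [[A [B C]] _]].
    apply (oriented_frame_eq e1 e2 e3); auto;
      rewrite !dot_plus_l, !dot_scal_l, ?(dot_comm e2 e1), ?(dot_comm e3 e1),
        ?(dot_comm e3 e2), ?A, ?B, ?C, ?A1, ?A2, ?A3; ring. }
  rewrite E at 1. rewrite !dot_plus_l, !dot_scal_l, !(dot_comm w). ring.
Qed.

(* The product of determinants [det (a,b,c) det (e1,e2,e3)] is the determinant
   of the matrix of scalar products. *)
Lemma oriented_frame_cross e1 e2 e3 a b :
  oriented_frame e1 e2 e3 -> dot a e3 = 0 -> dot b e3 = 0 ->
  cross a b = scal (dot a e1 * dot b e2 - dot a e2 * dot b e1) e3.
Proof.
  intros F Ha Hb.
  assert (E : forall c, dot (cross a b) c * det3 e1 e2 e3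
    = (dot a e1 * dot b e2 - dot a e2 * dot b e1) * dot c e3
    + (dot a e2 * dot b e3 - dot a e3 * dot b e2) * dot c e1
    + (dot a e3 * dot b e1 - dot a e1 * dot b e3) * dot c e2).
  { intros c. unfold det3, dot, cross, c1, c2, c3; simpl; ring. }
  pose proof F as [_ [_ H]]. rewrite H, Ha, Hb in E.
  apply (oriented_frame_eq e1 e2 e3); auto; rewrite dot_scal_l, ?(dot_comm e3 e1), ?(dot_comm e3 e2);
    [pose proof (E e1)|pose proof (E e2)|pose proof (E e3)]; lra.
Qed.

(** * Vector functions and the forms omega *)

Lemma class_C3_le D n m F : (m <= n)%nat -> class_C3 D n F -> class_C3 D m F.
Proof. intros mn [? [? ?]]. repeat split; now apply (class_C_le D n). Qed.

Lemma class_C3_opp D n F :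
  open D -> class_C3 D n F -> class_C3 D n (fun u v => opp (F u v)).
Proof. intros oD [? [? ?]]. repeat split; now apply class_C_opp. Qed.

Lemma class_C3_diff3 D n F t :
  open D -> class_C3 D (S n) F -> class_C3 D n (fun u v => diff3 F u v t).
Proof.
  intros oD [? [? ?]].
  repeat split; now apply (class_C_diff D n (fun a b => _ (F a b))).
Qed.

Lemma class_C_dot D n F G :
  open D -> class_C3 D n F -> class_C3 D n G ->
  class_C D n (fun u v => dot (F u v) (G u v)).
Proof.
  intros oD [? [? ?]] [? [? ?]].
  repeat apply class_C_plus; auto; now apply class_C_mult.
Qed.

Lemma class_C_omega D n F e t :
  open D -> class_C3 D (S n) F -> class_C3 D n e ->
  class_C D n (fun u v => omega F e u v t).
Proof. intros oD HF He. apply class_C_dot; auto. now apply class_C3_diff3. Qed.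

Lemma diff_dot D F G u v t :
  open D -> class_C3 D 1 F -> class_C3 D 1 G -> D (u, v) ->
  diff (fun a b => dot (F a b) (G a b)) u v t
  = dot (diff3 F u v t) (G u v) + dot (F u v) (diff3 G u v t).
Proof.
  intros oD [F1 [F2 F3]] [G1 [G2 G3]] Duv. unfold dot.
  rewrite !(diff_plus D), !(diff_mult D); auto;
    repeat apply class_C_plus; auto; try now apply class_C_mult.
  unfold diff3, c1, c2, c3; simpl. ring.
Qed.

Lemma diff3_comm D F u v s t :
  open D -> class_C3 D 2 F -> D (u, v) ->
  diff3 (fun a b => diff3 F a b s) u v t = diff3 (fun a b => diff3 F a b t) u v s.
Proof.
  intros oD [F1 [F2 F3]] Duv. unfold diff3 at 1 3.
  f_equal; [f_equal|];
    [apply (diff_comm D (fun a b => c1 (F a b)))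
    |apply (diff_comm D (fun a b => c2 (F a b)))
    |apply (diff_comm D (fun a b => c3 (F a b)))]; auto.
Qed.

Lemma diff3_plus_scal D x h e u v t :
  open D -> class_C3 D 1 x -> class_C D 1 h -> class_C3 D 1 e -> D (u, v) ->
  diff3 (fun a b => plus (x a b) (scal (h a b) (e a b))) u v t
  = plus (diff3 x u v t) (plus (scal (diff h u v t) (e u v)) (scal (h u v) (diff3 e u v t))).
Proof.
  intros oD [X1 [X2 X3]] Hh [E1 [E2 E3]] Duv.
  unfold diff3 at 1.
  assert (L : forall f g, class_C D 1 f -> class_C D 1 g ->
    diff (fun a b => f a b + h a b * g a b) u v t
    = diff f u v t + (diff h u v t * g u v + h u v * diff g u v t)).
  { intros f g Hf Hg. rewrite (diff_plus D), (diff_mult D); auto. now apply class_C_mult. }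
  apply (f_equal2 pair); [apply (f_equal2 pair)|].
  - exact (L _ _ X1 E1).
  - exact (L _ _ X2 E2).
  - exact (L _ _ X3 E3).
Qed.

Lemma omega_opp_r F e u v t : omega F (fun a b => opp (e a b)) u v t = - omega F e u v t.
Proof. apply dot_opp_r. Qed.

Lemma omega_linear F e u v t :
  omega F e u v t = fst t * omega F e u v (1, 0) + snd t * omega F e u v (0, 1).
Proof. unfold omega, dot, diff3, diff, c1, c2, c3; simpl; ring. Qed.

(** Differentiate the constant scalar product. With [e] equal to [f] this gives the vanishing of
    omega_ii. *)
Lemma omega_antisym D e f c u v t :
  open D -> class_C3 D 1 e -> class_C3 D 1 f -> D (u, v) ->
  (forall a b, D (a, b) -> dot (e a b) (f a b) = c) ->
  omega e f u v t = - omega f e u v t.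
Proof.
  intros oD He Hf Duv Hc.
  pose proof (diff_dot D e f u v t oD He Hf Duv) as H.
  rewrite (diff_ext D _ (fun _ _ => c)), diff_const in H; auto.
  unfold omega. rewrite (dot_comm (diff3 f u v t)). lra.
Qed.

(* On a neighbourhood of the point the unit normal is [n] or [-n], according to
   the sign of [lam]. *)
Lemma curvature_direction_of_normal y n lam u v t :
  locally_2d (fun a b => normal_vector y a b = scal (lam a b) (n a b)
                         /\ dot (n a b) (n a b) = 1) u v ->
  continuity_2d_pt lam u v -> lam u v <> 0 ->
  (curvature_direction y u v t <->
   exists k : R, diff3 n u v t = scal k (diff3 y u v t)).
Proof.
  intros Hn Cl nz.
  assert (reg : regular_at y u v).
  { intros E. destruct (locally_2d_singleton _ _ _ Hn) as [E' N].
    assert (Z : dot (normal_vector y u v) (n u v) = 0)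
      by (rewrite E; unfold dot, c1, c2, c3; simpl; ring).
    rewrite E', dot_scal_l, N in Z. lra. }
  assert (Hs : exists s, s * s = 1 /\
    locally_2d (fun a b => unit_normal y a b = scal s (n a b)) u v).
  (* [s] is the sign of [lam] at the point; continuity with tolerance |lam u v| keeps it on a
     neighbourhood. *)
  { assert (Hs : exists s, s * s = 1 /\ locally_2d (fun a b => 0 < s * lam a b) u v).
    { destruct (Rdichotomy _ _ nz) as [Hl|Hl]; [exists (-1)|exists 1]; (split; [ring|]).
      - destruct (Cl (mkposreal (- lam u v) ltac:(lra))) as [d Hd]. exists d.
        intros a b Ha Hb. specialize (Hd a b Ha Hb). simpl in Hd.
        apply Rabs_lt_between in Hd. lra.
      - destruct (Cl (mkposreal (lam u v) ltac:(lra))) as [d Hd]. exists d.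
        intros a b Ha Hb. specialize (Hd a b Ha Hb). simpl in Hd.
        apply Rabs_lt_between in Hd. lra. }
    destruct Hs as [s [ss Hs]]. exists s. split; auto.
    apply locally_2d_impl with (2 := Hs). apply locally_2d_impl with (2 := Hn).
    apply locally_2d_forall. intros a b [E N] pos.
    unfold unit_normal. cbv zeta. rewrite E.
    rewrite dot_scal_l, dot_comm, dot_scal_l, N, Rmult_1_r.
    (* The square root of the squared length is the positive number [s * lam a b]. *)
    replace (lam a b * lam a b) with ((s * lam a b) * (s * lam a b))
      by (transitivity ((s * s) * (lam a b * lam a b)); [ring|rewrite ss; ring]).
    rewrite sqrt_square by lra.
    rewrite scal_assoc. f_equal. unfold mult; simpl.
    assert (s <> 0) by (intros ->; lra).
    assert (lam a b <> 0) by (intros E0; rewrite E0 in pos; lra).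
    apply Rmult_eq_reg_l with s; auto. rewrite ss. field. auto. }
  destruct Hs as [s [ss Hs]].
  assert (Ed : diff3 (unit_normal y) u v t = scal s (diff3 n u v t)).
  { assert (L : forall c : E3 -> R, (forall a, c (scal s a) = s * c a) ->
      diff (fun a b => c (unit_normal y a b)) u v t
      = s * diff (fun a b => c (n a b)) u v t).
    { intros c Hc.
      assert (Hs' : locally_2d (fun a b => c (unit_normal y a b) = s * c (n a b)) u v).
      { apply locally_2d_impl with (2 := Hs), locally_2d_forall.
        intros a b ->. apply Hc. }
      unfold diff.
      rewrite (Derive_ext_loc (fun a : R => c (unit_normal y a v)) (fun a : R => s * c (n a v)) _
        (locally_2d_1d_const_y _ _ _ Hs')).
      rewrite (Derive_ext_loc (fun b : R => c (unit_normal y u b)) (fun b : R => s * c (n u b)) _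
        (locally_2d_1d_const_x _ _ _ Hs')).
      rewrite (Derive_scal (fun a : R => c (n a v))), (Derive_scal (fun b : R => c (n u b))).
      ring. }
    unfold diff3. apply (f_equal2 pair); [apply (f_equal2 pair)|]; now apply L. }
  split.
  (* As [s * s = 1], multiplying Rodrigues' formula by [s] turns the differential of the unit normal
     into that of [n]. *)
  - intros [_ [k Hk]]. exists (s * - k).
    change (s * - k) with (mult s (- k)). rewrite <- scal_assoc, <- Hk, Ed, scal_assoc.
    unfold mult; simpl. rewrite ss. symmetry. apply (scal_one (diff3 n u v t)).
  - intros [k Hk]. split; auto. exists (- (s * k)).
    rewrite Ed, Hk, scal_assoc. f_equal. unfold mult; simpl. ring.
Qed.

(** * Surfaces with a principal frame *)

Lemma principal_frame_oriented D r x e1 e2 e3 k1 k2 q1 q2 u v :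
  principal_frame D r x e1 e2 e3 k1 k2 q1 q2 -> D (u, v) ->
  oriented_frame (e1 u v) (e2 u v) (e3 u v).
Proof.
  intros hf Duv. repeat apply conj; try apply hf; auto.
Qed.

(** Turning the frame replaces (omega_1, omega_2) by (omega_2, - omega_1) and keeps omega_12, whose
    coefficients thereby become [q2] and [- q1]. This reduces statements about the second central
    surface to the first. *)
Lemma principal_frame_turn D r x e1 e2 e3 k1 k2 q1 q2 :
  open D -> (4 <= r)%nat ->
  principal_frame D r x e1 e2 e3 k1 k2 q1 q2 ->
  principal_frame D r x e2 (fun u v => opp (e1 u v)) e3 k2 k1 q2 (fun u v => - q1 u v).
Proof.
  intros oD hr hf.
  assert (F := fun u v => principal_frame_oriented _ _ _ _ _ _ _ _ _ _ u v hf).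
  assert (F' := fun u v H => oriented_frame_turn _ _ _ (F u v H)).
  destruct (frame_class _ _ _ _ _ _ _ _ _ _ hf) as [He1 [He2 He3]].
  split; try (intros u v Duv; now apply F').
  - repeat split; try apply He2; try apply He3; now apply class_C3_opp.
  - intros u v t Duv. rewrite omega_opp_r, (frame_dx _ _ _ _ _ _ _ _ _ _ hf _ _ _ Duv).
    rewrite scal_Ropp_opp. apply plus_comm.
  - intros u v t Duv. apply (frame_omega32 _ _ _ _ _ _ _ _ _ _ hf _ _ _ Duv).
  - intros u v t Duv. rewrite !omega_opp_r, (frame_omega31 _ _ _ _ _ _ _ _ _ _ hf _ _ _ Duv). ring.
  - intros u v t Duv. rewrite !omega_opp_r.
    rewrite (omega_antisym D e2 e1 0); auto.
    + rewrite (frame_omega12 _ _ _ _ _ _ _ _ _ _ hf _ _ _ Duv). ring.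
    + apply class_C3_le with (2 := He2); lia.
    + apply class_C3_le with (2 := He1); lia.
    + intros a b Dab. rewrite dot_comm. now apply F.
Qed.

Lemma pfaffian_turn D x e1 e2 f g1 g2 :
  pfaffian D x e1 e2 f g1 g2 ->
  pfaffian D x e2 (fun u v => opp (e1 u v)) f g2 (fun u v => - g1 u v).
Proof. intros H u v t Duv. rewrite (H u v t Duv), omega_opp_r. ring. Qed.

(** The value of the area form omega_1 ∧ omega_2 on the coordinate basis. *)
Definition coframe_det (x e1 e2 : R -> R -> E3) (u v : R) : R :=
  omega x e1 u v (1, 0) * omega x e2 u v (0, 1)
  - omega x e2 u v (1, 0) * omega x e1 u v (0, 1).

Section PrincipalFrame.

Context (D : R * R -> Prop) (r : nat) (x e1 e2 e3 : R -> R -> E3)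
  (k1 k2 q1 q2 : R -> R -> R) (hr : (4 <= r)%nat) (hx : surface D r x)
  (hf : principal_frame D r x e1 e2 e3 k1 k2 q1 q2).

Let oD : open D := surface_open _ _ _ hx.

(** Here [4 <= r] enters: second derivatives of [e3] must commute in the Codazzi equation. *)
Lemma frame_class2 : class_C3 D 2 e1 /\ class_C3 D 2 e2 /\ class_C3 D 2 e3.
Proof.
  destruct (frame_class _ _ _ _ _ _ _ _ _ _ hf) as [H1 [H2 H3]].
  repeat apply conj; (apply class_C3_le with (n := (r - 2)%nat); [lia|assumption]).
Qed.

Lemma frame_class1 : class_C3 D 1 e1 /\ class_C3 D 1 e2 /\ class_C3 D 1 e3.
Proof.
  destruct frame_class2 as [H1 [H2 H3]].
  repeat apply conj; (apply class_C3_le with (n := 2%nat); [lia|assumption]).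
Qed.

Lemma surface_class2 : class_C3 D 2 x.
Proof. apply class_C3_le with (2 := surface_class _ _ _ hx). lia. Qed.

Lemma dx_tangent u v t : D (u, v) -> dot (diff3 x u v t) (e3 u v) = 0.
Proof.
  intros Duv. rewrite (frame_dx _ _ _ _ _ _ _ _ _ _ hf _ _ _ Duv), dot_plus_l, !dot_scal_l.
  destruct (frame_orthogonal _ _ _ _ _ _ _ _ _ _ hf _ _ Duv) as [_ [-> ->]]. ring.
Qed.

Lemma de3_tangent u v t : D (u, v) -> dot (diff3 e3 u v t) (e3 u v) = 0.
Proof.
  intros Duv. destruct frame_class1 as [_ [_ H]].
  pose proof (omega_antisym D e3 e3 1 u v t oD H H Duv) as E.
  unfold omega in E. cut (forall c : R, c = - c -> c = 0).
  - intros Z. apply Z, E. intros a b Dab. now apply hf.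
  - intros; lra.
Qed.

(** The normal vector of the surface is [coframe_det] times [e3], and the surface is regular. *)
Lemma coframe_det_neq_0 u v : D (u, v) -> coframe_det x e1 e2 u v <> 0.
Proof.
  intros Duv E. apply (surface_regular _ _ _ hx u v Duv). unfold normal_vector.
  rewrite (oriented_frame_cross (e1 u v) (e2 u v) (e3 u v));
    [|now apply principal_frame_oriented with (1 := hf)|now apply dx_tangent|now apply dx_tangent].
  change (scal (coframe_det x e1 e2 u v) (e3 u v) = (0, 0, 0)).
  rewrite E.
  change ((0 * c1 (e3 u v), 0 * c2 (e3 u v), 0 * c3 (e3 u v)) = (0, 0, 0)).
  now rewrite !Rmult_0_l.
Qed.

(** Cramer's rule again. It supplies tangent vectors dual to omega_1, omega_2, on which identities
    between forms become identities between coefficients. *)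
Lemma coframe_surjective u v a b :
  D (u, v) -> exists t, omega x e1 u v t = a /\ omega x e2 u v t = b.
Proof.
  intros Duv. pose proof (coframe_det_neq_0 u v Duv) as nz. unfold coframe_det in nz.
  set (t := ((a * omega x e2 u v (0, 1) - b * omega x e1 u v (0, 1)) / coframe_det x e1 e2 u v,
             (b * omega x e1 u v (1, 0) - a * omega x e2 u v (1, 0)) / coframe_det x e1 e2 u v)).
  exists t. rewrite (omega_linear x e1 u v t), (omega_linear x e2 u v t).
  unfold t, coframe_det. cbn [fst snd]. split; field; auto.
Qed.

(** Curvatures and Pfaffian derivatives are given only as coefficients of one-forms, with no
    regularity of their own. Solving for them by Cramer's rule transfers the class of the form [W],
    up to order 1, the order at which the coframe enters. *)
Lemma class_C_coefficients n (W : R * R -> R -> R -> R) (g1 g2 : R -> R -> R) :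
  (n <= 1)%nat ->
  class_C D n (W (1, 0)) -> class_C D n (W (0, 1)) ->
  (forall u v t, D (u, v) ->
     W t u v = g1 u v * omega x e1 u v t + g2 u v * omega x e2 u v t) ->
  class_C D n g1 /\ class_C D n g2.
Proof.
  intros hn W1 W2 H.
  destruct frame_class1 as [E1 [E2 _]].
  assert (C1 : forall t, class_C D n (fun u v => omega x e1 u v t)).
  { intros t. apply class_C_le with 1%nat; auto.
    apply class_C_omega; auto. apply surface_class2. }
  assert (C2 : forall t, class_C D n (fun u v => omega x e2 u v t)).
  { intros t. apply class_C_le with 1%nat; auto.
    apply class_C_omega; auto. apply surface_class2. }
  assert (J : class_C D n (coframe_det x e1 e2))
    by (apply class_C_minus; auto; now apply class_C_mult).
  split.
  - apply class_C_ext with (fun u v => (W (1, 0) u v * omega x e2 u v (0, 1)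
      - W (0, 1) u v * omega x e2 u v (1, 0)) / coframe_det x e1 e2 u v); auto.
    + intros u v Duv. rewrite !H by auto.
      pose proof (coframe_det_neq_0 u v Duv). unfold coframe_det in *. now field.
    + apply class_C_div; auto using coframe_det_neq_0.
      apply class_C_minus; auto; now apply class_C_mult.
  - apply class_C_ext with (fun u v => (W (0, 1) u v * omega x e1 u v (1, 0)
      - W (1, 0) u v * omega x e1 u v (0, 1)) / coframe_det x e1 e2 u v); auto.
    + intros u v Duv. rewrite !H by auto.
      pose proof (coframe_det_neq_0 u v Duv). unfold coframe_det in *. now field.
    + apply class_C_div; auto using coframe_det_neq_0.
      apply class_C_minus; auto; now apply class_C_mult.
Qed.

Lemma class_C_k1 : class_C D 1 k1.
Proof.
  destruct frame_class2 as [_ [_ E3]], frame_class1 as [E1 _].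
  apply (class_C_coefficients 1 (fun t u v => - omega e3 e1 u v t) k1 (fun _ _ => 0));
    auto.
  - apply class_C_opp; auto. now apply class_C_omega.
  - apply class_C_opp; auto. now apply class_C_omega.
  - intros u v t Duv. rewrite (frame_omega31 _ _ _ _ _ _ _ _ _ _ hf _ _ _ Duv). ring.
Qed.

Lemma class_C_q : class_C D 0 q1 /\ class_C D 0 q2.
Proof.
  destruct frame_class1 as [E1 [E2 _]].
  apply (class_C_coefficients 0 (fun t u v => omega e1 e2 u v t)); auto.
  - apply class_C_omega; auto. apply class_C3_le with (2 := E2); auto.
  - apply class_C_omega; auto. apply class_C3_le with (2 := E2); auto.
  - intros u v t Duv. apply (frame_omega12 _ _ _ _ _ _ _ _ _ _ hf _ _ _ Duv).
Qed.

Lemma class_C_pfaffian f g1 g2 :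
  class_C D 1 f -> pfaffian D x e1 e2 f g1 g2 -> class_C D 0 g1 /\ class_C D 0 g2.
Proof.
  intros Hf P.
  apply (class_C_coefficients 0 (fun t u v => diff f u v t)); auto;
    now apply class_C_diff.
Qed.

(* The e1-component of the exterior derivative of
   de3 + k1 dx = (k1 - k2) omega_2 e2. *)
Lemma codazzi d1k1 d2k1 u v :
  pfaffian D x e1 e2 k1 d1k1 d2k1 -> D (u, v) ->
  d2k1 u v = q1 u v * (k1 u v - k2 u v).
Proof.
  intros P Duv.
  destruct frame_class2 as [_ [_ F3]], frame_class1 as [F1 _].
  pose proof surface_class2 as X.
  assert (F := principal_frame_oriented _ _ _ _ _ _ _ _ _ _ u v hf Duv).
  (* Differentiate, along [t], the identity omega_31(s) + k1 omega_1(s) = 0 with [s] held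
     constant. *)
  assert (E : forall s t,
    (dot (diff3 (fun a b => diff3 e3 a b s) u v t) (e1 u v)
     + dot (diff3 e3 u v s) (diff3 e1 u v t))
    + (diff k1 u v t * omega x e1 u v s
       + k1 u v * (dot (diff3 (fun a b => diff3 x a b s) u v t) (e1 u v)
                   + dot (diff3 x u v s) (diff3 e1 u v t))) = 0).
  { intros s t.
    assert (K := class_C_k1).
    assert (A3 : class_C3 D 1 (fun a b => diff3 e3 a b s)) by now apply class_C3_diff3.
    assert (AX : class_C3 D 1 (fun a b => diff3 x a b s)) by now apply class_C3_diff3.
    unfold omega.
    rewrite <- !(diff_dot D (fun a b => diff3 _ a b s) e1 u v t); auto.
    rewrite <- (diff_mult D k1 (fun a b => dot (diff3 x a b s) (e1 a b))); auto;
      [|now apply class_C_dot].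
    rewrite <- (diff_plus D); auto;
      [|now apply class_C_dot|apply class_C_mult; auto; now apply class_C_dot].
    rewrite (diff_ext D _ (fun _ _ => 0)); auto; [apply diff_const|].
    intros a b Dab. pose proof (frame_omega31 _ _ _ _ _ _ _ _ _ _ hf a b s Dab) as H.
    unfold omega in H. rewrite H. ring. }
  (* With [s], [t] dual to the coframe, comparing [E s t] and [E t s] cancels the symmetric second
     derivatives; only nabla_2 k1 and the term q1 (k1 - k2) survive. *)
  destruct (coframe_surjective u v 1 0 Duv) as [s [s1 s2]].
  destruct (coframe_surjective u v 0 1 Duv) as [t [t1 t2]].
  assert (G : forall s t, dot (diff3 e3 u v s) (diff3 e1 u v t)
                          + k1 u v * dot (diff3 x u v s) (diff3 e1 u v t)
     = (k1 u v - k2 u v) * omega x e2 u v s * omega e1 e2 u v t).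
  { clear s s1 s2 t t1 t2. intros s t.
    rewrite !(oriented_frame_dot _ _ _ (diff3 _ u v s) (diff3 e1 u v t) F).
    rewrite de3_tangent, dx_tangent by auto.
    pose proof (frame_omega31 _ _ _ _ _ _ _ _ _ _ hf u v s Duv) as H1.
    pose proof (frame_omega32 _ _ _ _ _ _ _ _ _ _ hf u v s Duv) as H2.
    unfold omega in *. rewrite H1, H2. ring. }
  pose proof (E s t) as Est. pose proof (E t s) as Ets.
  pose proof (G s t) as Gst. pose proof (G t s) as Gts.
  rewrite (diff3_comm D e3 u v t s), (diff3_comm D x u v t s) in Ets; auto.
  rewrite (P u v t Duv), s1, t1, t2 in Est. rewrite (P u v s Duv), t1 in Ets.
  rewrite s2 in Gst.
  rewrite (frame_omega12 _ _ _ _ _ _ _ _ _ _ hf u v s Duv), s1, s2, t2 in Gts.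
  lra.
Qed.

(** * Lines of curvature of the central surfaces *)

Lemma central_surface_differential u v t d1k1 d2k1 :
  pfaffian D x e1 e2 k1 d1k1 d2k1 ->
  (forall a b, D (a, b) -> k1 a b <> 0) -> D (u, v) ->
  let dy := diff3 (central_surface x e3 k1) u v t in
  dot dy (e1 u v) = 0 /\
  dot dy (e2 u v) = (1 - k2 u v / k1 u v) * omega x e2 u v t /\
  dot dy (e3 u v) = - (d1k1 u v * omega x e1 u v t + d2k1 u v * omega x e2 u v t) / k1 u v ^ 2.
Proof.
  intros P nz Duv dy.
  destruct frame_class1 as [_ [_ F3]].
  assert (H : class_C D 1 (fun a b => 1 / k1 a b)).
  { apply class_C_div; auto. now apply class_C_const. apply class_C_k1. }
  assert (X : class_C3 D 1 x).
  { apply class_C3_le with (2 := surface_class2). auto. }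
  assert (E := diff3_plus_scal D x _ e3 u v t oD X H F3 Duv).
  fold (central_surface x e3 k1) in E.
  unfold dy, central_surface. rewrite E. clear E.
  rewrite !dot_plus_l, !dot_scal_l.
  destruct (principal_frame_oriented _ _ _ _ _ _ _ _ _ _ u v hf Duv)
    as [[_ [_ O33]] [[_ [O13 O23]] _]].
  rewrite (dot_comm (e3 u v) (e1 u v)), (dot_comm (e3 u v) (e2 u v)), O13, O23, O33.
  rewrite dx_tangent, de3_tangent by auto.
  pose proof (frame_omega31 _ _ _ _ _ _ _ _ _ _ hf u v t Duv) as H1.
  pose proof (frame_omega32 _ _ _ _ _ _ _ _ _ _ hf u v t Duv) as H2.
  unfold omega in H1, H2 |- *. rewrite H1, H2.
  rewrite (diff_ext D (fun a b => 1 / k1 a b) (fun a b => / k1 a b)); auto;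
    [|intros; unfold Rdiv; ring].
  rewrite (diff_inv D), (P u v t Duv); auto using class_C_k1.
  unfold omega. specialize (nz u v Duv).
  repeat split; field; auto.
Qed.

Lemma central_surface_net d1k1 d2k1 :
  pfaffian D x e1 e2 k1 d1k1 d2k1 ->
  (forall a b, D (a, b) -> k1 a b <> 0) ->
  (forall a b, D (a, b) -> k1 a b <> k2 a b /\ d1k1 a b <> 0) ->
  class_C D 1 k2 ->
  net_of_curvature_lines D x e1 e2 (central_surface x e3 k1)
    (central_net k1 k2 q1 q2 k1 d1k1 d2k1).
Proof.
  intros P nz nc K2 u v t Duv.
  assert (F := fun a b => principal_frame_oriented _ _ _ _ _ _ _ _ _ _ a b hf).
  (* The wedge of the [e2] and [e3] components of dy on the coordinate basis; the terms in nabla_2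
     k1 cancel. It is nonzero because k1 <> k2 and nabla_1 k1 <> 0, so the central surface is
     regular. *)
  set (lam := fun a b => coframe_det x e1 e2 a b
                         * (d1k1 a b * (k1 a b - k2 a b) / k1 a b ^ 3)).
  assert (N : forall a b, D (a, b) ->
    normal_vector (central_surface x e3 k1) a b = scal (lam a b) (e1 a b)).
  { intros a b Dab.
    destruct (central_surface_differential a b (1, 0) _ _ P nz Dab) as [A1 [A2 A3]].
    destruct (central_surface_differential a b (0, 1) _ _ P nz Dab) as [B1 [B2 B3]].
    unfold normal_vector.
    rewrite (oriented_frame_cross (e2 a b) (e3 a b) (e1 a b)); auto.
    - f_equal. rewrite A2, A3, B2, B3. unfold lam, coframe_det.
      specialize (nz a b Dab). now field.
    - now apply oriented_frame_cycle, F. }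
  assert (Cl : continuity_2d_pt lam u v).
  { destruct frame_class1 as [E1 [E2 _]].
    assert (C1 : forall s, class_C D 0 (fun a b => omega x e1 a b s)).
    { intros s. apply class_C_le with 1%nat; auto.
      apply class_C_omega; auto. apply surface_class2. }
    assert (C2 : forall s, class_C D 0 (fun a b => omega x e2 a b s)).
    { intros s. apply class_C_le with 1%nat; auto.
      apply class_C_omega; auto. apply surface_class2. }
    assert (K : class_C D 0 k1) by (apply class_C_le with (2 := class_C_k1); auto).
    assert (K' : class_C D 0 k2) by (apply class_C_le with (2 := K2); auto).
    destruct (class_C_pfaffian _ _ _ class_C_k1 P) as [G1 _].
    apply class_C_continuous with (2 := Duv) (n := 0%nat).
    apply class_C_mult; [auto|apply class_C_minus; auto; now apply class_C_mult|].
    apply class_C_div; auto.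
    - intros a b Dab. apply pow_nonzero. auto.
    - apply class_C_mult; auto. now apply class_C_minus.
    - simpl. repeat apply class_C_mult; auto. now apply class_C_const. }
  assert (Hk := nz u v Duv). destruct (nc u v Duv) as [kk dk].
  assert (nl : lam u v <> 0).
  { unfold lam. apply Rmult_integral_contrapositive. split.
    - now apply coframe_det_neq_0.
    - apply Rmult_integral_contrapositive. split.
      + apply Rmult_integral_contrapositive. split; auto. lra.
      + now apply Rinv_neq_0_compat, pow_nonzero. }
  rewrite (curvature_direction_of_normal _ e1 lam); auto.
  2:{ apply (locally_2d_open D); auto. intros a b Dab. split; auto. now apply F. }
  destruct (central_surface_differential u v t _ _ P nz Duv) as [Y1 [Y2 Y3]].
  set (dy := diff3 (central_surface x e3 k1) u v t) in *.
  assert (W1 : dot (diff3 e1 u v t) (e1 u v) = 0).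
  { destruct frame_class1 as [H _].
    pose proof (omega_antisym D e1 e1 1 u v t oD H H Duv) as E. unfold omega in E.
    enough (dot (diff3 e1 u v t) (e1 u v) = - dot (diff3 e1 u v t) (e1 u v)) by lra.
    apply E. intros a b Dab. now apply F. }
  assert (W2 := frame_omega12 _ _ _ _ _ _ _ _ _ _ hf u v t Duv).
  assert (W3 : omega e1 e3 u v t = k1 u v * omega x e1 u v t).
  { destruct frame_class1 as [H [_ H3]].
    rewrite (omega_antisym D e1 e3 0); auto.
    - rewrite (frame_omega31 _ _ _ _ _ _ _ _ _ _ hf u v t Duv). ring.
    - intros a b Dab. now apply F. }
  unfold omega at 1 in W2. unfold omega at 1 in W3.
  set (w1 := omega x e1 u v t) in *. set (w2 := omega x e2 u v t) in *.
  cbv beta iota delta [on_net central_net net_A net_B net_C].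
  set (K1 := k1 u v) in *. set (K2' := k2 u v) in *.
  (* The net is the vanishing of the determinant of [de1] and [dy] in the
     plane of e2, e3. *)
  assert (Det : q1 u v * d1k1 u v * w1 ^ 2
     + (K1 ^ 2 * (K1 - K2') + q2 u v * d1k1 u v + q1 u v * d2k1 u v) * (w1 * w2)
     + q2 u v * d2k1 u v * w2 ^ 2
     = K1 ^ 2 * (dot (diff3 e1 u v t) (e3 u v) * dot dy (e2 u v)
                 - dot (diff3 e1 u v t) (e2 u v) * dot dy (e3 u v))).
  { rewrite W2, W3, Y2, Y3. now field. }
  rewrite Det. split.
  - intros [k Hk'].  rewrite Hk', !dot_scal_l. ring.
  - intros Z. apply Rmult_integral in Z. destruct Z as [Z|Z].
    { exfalso. now apply (pow_nonzero K1 2 Hk). }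
    (* The factor [k] is the quotient of components of de1 and dy at a nonzero component of dy. If
       dy = 0, then k1 <> k2 and nabla_1 k1 <> 0 force omega_1 = omega_2 = 0, so de1 = 0 as well. *)
    destruct (Req_dec (dot dy (e2 u v)) 0) as [p0|p0].
    + destruct (Req_dec (dot dy (e3 u v)) 0) as [p1|p1].
      * exists 0.
        assert (w20 : w2 = 0).
        { rewrite Y2 in p0. apply Rmult_integral in p0. destruct p0 as [p0|p0]; auto.
          exfalso. apply kk. apply Rmult_eq_compat_r with (r := K1) in p0.
          field_simplify in p0; auto. lra. }
        assert (w10 : w1 = 0).
        { rewrite Y3, w20 in p1. apply Rmult_eq_compat_r with (r := K1 ^ 2) in p1.
          field_simplify in p1; auto.
          assert (p2 : d1k1 u v * w1 = 0) by lra.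
          apply Rmult_integral in p2. now destruct p2. }
        apply (oriented_frame_eq _ _ _ _ _ (F u v Duv));
          rewrite dot_scal_l, ?W1, ?W2, ?W3, ?w10, ?w20; ring.
      * exists (dot (diff3 e1 u v t) (e3 u v) / dot dy (e3 u v)).
        apply (oriented_frame_eq _ _ _ _ _ (F u v Duv)); rewrite dot_scal_l.
        -- rewrite W1, Y1. ring.
        -- apply Rmult_eq_reg_r with (dot dy (e3 u v)); auto. field_simplify; auto. lra.
        -- now field.
    + exists (dot (diff3 e1 u v t) (e2 u v) / dot dy (e2 u v)).
      apply (oriented_frame_eq _ _ _ _ _ (F u v Duv)); rewrite dot_scal_l.
      * rewrite W1, Y1. ring.
      * now field.
      * apply Rmult_eq_reg_r with (dot dy (e2 u v)); auto. field_simplify; auto. lra.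
Qed.

End PrincipalFrame.

(** * Orthogonality of the spherical images *)

(** Clearing denominators gives the polynomial relation a + b - c a b = 0, smooth on the whole
    plane. Along (k1,k2) its first partial derivative 1 - c k2 equals - k2 / k1, which is not 0. *)
Lemma W_surface_of_sum_inv_const D k1 k2 c :
  (forall u v, D (u, v) -> k1 u v * k2 u v <> 0) ->
  (forall u v, D (u, v) -> 1 / k1 u v + 1 / k2 u v = c) ->
  W_surface D k1 k2.
Proof.
  intros nz Hc.
  assert (Da : forall a b, is_derive (fun s : R => s + b - c * (s * b)) a (1 - c * b))
    by (intros; auto_derive; [auto|ring]).
  assert (Db : forall a b, is_derive (fun s : R => a + s - c * (a * s)) b (1 - c * a))
    by (intros; auto_derive; [auto|ring]).
  exists (fun a b => a + b - c * (a * b)). split.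
  - assert (oT : open (fun _ : R * R => True)) by apply open_true.
    assert (C1 : class_C (fun _ => True) 1 (fun a b => a + b - c * (a * b))).
    { apply class_C_S with (fun _ b => 1 - c * b) (fun a _ => 1 - c * a); auto;
        intros u v _; repeat split;
        repeat first [apply continuity_2d_pt_minus | apply continuity_2d_pt_plus
          | apply continuity_2d_pt_mult | apply continuity_2d_pt_const
          | apply continuity_2d_pt_id1 | apply continuity_2d_pt_id2]. }
    intros a b. now apply C1.
  - intros u v Duv. specialize (nz u v Duv). specialize (Hc u v Duv).
    assert (n1 : k1 u v <> 0) by (intros E; apply nz; rewrite E; ring).
    assert (n2 : k2 u v <> 0) by (intros E; apply nz; rewrite E; ring).
    rewrite (is_derive_unique (fun s : R => s + k2 u v - c * (s * k2 u v)) _ _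
      (Da (k1 u v) (k2 u v))).
    split.
    + rewrite <- Hc. now field.
    + left. replace (1 - c * k2 u v) with (- (k2 u v / k1 u v)) by (rewrite <- Hc; now field).
      apply Ropp_neq_0_compat, Rmult_integral_contrapositive. split; auto.
      now apply Rinv_neq_0_compat.
Qed.

Theorem proposition6 (D : R * R -> Prop) (r : nat) (x : R -> R -> E3)
    (e1 e2 e3 : R -> R -> E3) (k1 k2 q1 q2 : R -> R -> R)
    (d1k1 d2k1 d1k2 d2k2 : R -> R -> R)
    (hr : (4 <= r)%nat)
    (hx : surface D r x)
    (hframe : principal_frame D r x e1 e2 e3 k1 k2 q1 q2)
    (hk1 : pfaffian D x e1 e2 k1 d1k1 d2k1)
    (hk2 : pfaffian D x e1 e2 k2 d1k2 d2k2)
    (hparabolic : no_parabolic_points D k1 k2)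
    (hcanal : not_canal D k1 k2 d1k1 d2k2)
    (hmoulding : ~ moulding D q1 q2) :
  let N1 := central_net k1 k2 q1 q2 k1 d1k1 d2k1 in
  let N2 := central_net k1 k2 q1 q2 k2 d1k2 d2k2 in
  net_of_curvature_lines D x e1 e2 (central_surface x e3 k1) N1 /\
  net_of_curvature_lines D x e1 e2 (central_surface x e3 k2) N2 /\
  ((orthogonal_net D (spherical_image k1 k2 N1) /\
    orthogonal_net D (spherical_image k1 k2 N2)) <->
   (W_surface D k1 k2 /\
    exists c : R, forall u v, D (u, v) -> 1 / k1 u v + 1 / k2 u v = c)).
Proof.
  intros N1 N2.
  assert (oD : open D) by apply hx.
  assert (hframe' := principal_frame_turn _ _ _ _ _ _ _ _ _ _ oD hr hframe).
  assert (hk1' := pfaffian_turn _ _ _ _ _ _ _ hk1).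
  assert (hk2' := pfaffian_turn _ _ _ _ _ _ _ hk2).
  assert (K1 := class_C_k1 _ _ _ _ _ _ _ _ _ _ hr hx hframe).
  assert (K2 := class_C_k1 _ _ _ _ _ _ _ _ _ _ hr hx hframe').
  assert (n1 : forall u v, D (u, v) -> k1 u v <> 0).
  { intros u v Duv E. apply (hparabolic u v Duv). rewrite E. ring. }
  assert (n2 : forall u v, D (u, v) -> k2 u v <> 0).
  { intros u v Duv E. apply (hparabolic u v Duv). rewrite E. ring. }
  split.
  { apply (central_surface_net _ _ _ _ _ _ _ _ _ _ hr hx hframe); auto.
    intros a b Dab. destruct (hcanal a b Dab). tauto. }
  split.
  { assert (H := central_surface_net _ _ _ _ _ _ _ _ _ _ hr hx hframe' _ _ hk2' n2
      (fun a b Dab => conj (not_eq_sym (proj1 (hcanal a b Dab)))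
                           (proj2 (proj2 (hcanal a b Dab)))) K1).
    intros u v t Duv. rewrite (H u v t Duv).
    unfold N2. cbv beta iota delta [on_net central_net net_A net_B net_C].
    (* In the turned frame the outer coefficients change places and the two sign changes in the
       middle term cancel, so the equation of [N2] comes out exactly. *)
    rewrite omega_opp_r.
    split; intros Z; rewrite <- Z; ring. }
  assert (Cod1 := fun u v => codazzi _ _ _ _ _ _ _ _ _ _ hr hx hframe _ _ u v hk1).
  assert (Cod2 : forall u v, D (u, v) -> d1k2 u v = q2 u v * (k1 u v - k2 u v)).
  { intros u v Duv.
    pose proof (codazzi _ _ _ _ _ _ _ _ _ _ hr hx hframe' _ _ u v hk2' Duv). lra. }
  (* [m1] and [m2] are the Pfaffian derivatives of 1/k1 + 1/k2 multiplied by - k1^2 k2^2. *)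
  set (m1 := fun u v => d1k1 u v * k2 u v ^ 2 + d1k2 u v * k1 u v ^ 2).
  set (m2 := fun u v => d2k1 u v * k2 u v ^ 2 + d2k2 u v * k1 u v ^ 2).
  assert (dS : forall u v t, D (u, v) ->
    diff (fun a b => 1 / k1 a b + 1 / k2 a b) u v t
    = - (m1 u v * omega x e1 u v t + m2 u v * omega x e2 u v t)
      / (k1 u v ^ 2 * k2 u v ^ 2)).
  { intros u v t Duv.
    rewrite (diff_ext D _ (fun a b => / k1 a b + / k2 a b)); auto;
      [|intros; unfold Rdiv; ring].
    rewrite (diff_plus D); auto using class_C_inv.
    rewrite !(diff_inv D), (hk1 u v t Duv), (hk2 u v t Duv); auto.
    unfold m1, m2. field; auto. }
  assert (CS : class_C D 1 (fun a b => 1 / k1 a b + 1 / k2 a b)).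
  { apply class_C_plus; auto; apply class_C_div; auto; now apply class_C_const. }
  (* By Codazzi, q2 nabla_2 k1 and q1 nabla_1 k2 both equal q1 q2 (k1 - k2). Exchanging one for the
     other lets q1 factor out here, and q2 in [Orth2]. *)
  assert (Orth1 : forall u v, D (u, v) ->
    net_A (spherical_image k1 k2 N1) u v + net_C (spherical_image k1 k2 N1) u v
    = q1 u v * m1 u v / (k1 u v ^ 2 * k2 u v ^ 2)).
  { intros u v Duv.
    unfold N1, m1. cbv beta iota delta [spherical_image central_net net_A net_C].
    rewrite (Cod1 u v Duv), (Cod2 u v Duv). field. auto. }
  assert (Orth2 : forall u v, D (u, v) ->
    net_A (spherical_image k1 k2 N2) u v + net_C (spherical_image k1 k2 N2) u v
    = q2 u v * m2 u v / (k1 u v ^ 2 * k2 u v ^ 2)).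
  { intros u v Duv.
    unfold N2, m2. cbv beta iota delta [spherical_image central_net net_A net_C].
    rewrite (Cod1 u v Duv), (Cod2 u v Duv). field. auto. }
  assert (nzP : forall u v, D (u, v) -> k1 u v ^ 2 * k2 u v ^ 2 <> 0).
  { intros u v Duv. apply Rmult_integral_contrapositive.
    split; apply pow_nonzero; auto. }
  assert (div0 : forall a b, b <> 0 -> a / b = 0 <-> a = 0).
  { intros a b nb. split; intros E; [|rewrite E; unfold Rdiv; ring].
    apply Rmult_integral in E. destruct E as [E|E]; auto.
    exfalso. now apply (Rinv_neq_0_compat b nb). }
  split.
  - intros [O1 O2].
    assert (Z1 : forall u v, D (u, v) -> q1 u v * m1 u v = 0).
    { intros u v Duv. apply (div0 _ _ (nzP u v Duv)). rewrite <- Orth1; auto. }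
    assert (Z2 : forall u v, D (u, v) -> q2 u v * m2 u v = 0).
    { intros u v Duv. apply (div0 _ _ (nzP u v Duv)). rewrite <- Orth2; auto. }
    (* Where q1 vanishes, so does nabla_2 k1 by Codazzi; then m2 = nabla_2 k2 k1^2
       is not 0, hence q2 = 0, and m1 = nabla_1 k1 k2^2 is not 0 either. *)
    assert (Zq2 : forall u v, D (u, v) -> q1 u v = 0 -> q2 u v = 0).
    { intros u v Duv E. destruct (Rmult_integral _ _ (Z2 u v Duv)) as [|M]; auto.
      exfalso. unfold m2 in M. rewrite (Cod1 u v Duv), E in M.
      destruct (hcanal u v Duv) as [_ [_ nd]].
      apply (Rmult_integral_contrapositive (d2k2 u v) (k1 u v ^ 2)).
      - split; auto. apply pow_nonzero; auto.
      - lra. }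
    assert (Zq1 : forall u v, D (u, v) -> q1 u v = 0 <-> m1 u v <> 0).
    { intros u v Duv. split.
      - intros E. unfold m1. rewrite (Cod2 u v Duv), (Zq2 u v Duv E).
        destruct (hcanal u v Duv) as [_ [nd _]].
        replace (_ + _) with (d1k1 u v * k2 u v ^ 2) by ring.
        apply Rmult_integral_contrapositive. split; auto. apply pow_nonzero; auto.
      - intros M. destruct (Rmult_integral _ _ (Z1 u v Duv)); tauto. }
    destruct (class_C_q _ _ _ _ _ _ _ _ _ _ hr hx hframe) as [Q1 _].
    assert (M1 : class_C D 0 m1).
    { destruct (class_C_pfaffian _ _ _ _ _ _ _ _ _ _ hr hx hframe _ _ _ K1 hk1) as [A _].
      destruct (class_C_pfaffian _ _ _ _ _ _ _ _ _ _ hr hx hframe _ _ _ K2 hk2) as [B _].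
      assert (K1' : class_C D 0 k1) by (apply class_C_le with (2 := K1); auto).
      assert (K2' : class_C D 0 k2) by (apply class_C_le with (2 := K2); auto).
      unfold m1. simpl.
      apply class_C_plus; auto; repeat apply class_C_mult; auto; now apply class_C_const. }
    assert (q1nz : forall u v, D (u, v) -> q1 u v <> 0).
    { apply (connected_neq_0 D q1 m1); auto; try apply hx;
        try (intros u v Duv; now apply (class_C_continuous D 0)).
      (* If q1 were zero at every point, the surface would be a moulding surface. *)
      apply NNPP. intros N. apply hmoulding. left. intros u v Duv.
      apply NNPP. intros nq. apply N. now exists u, v. }
    assert (Hm : forall u v, D (u, v) -> m1 u v = 0 /\ m2 u v = 0).
    { intros u v Duv. assert (E1 : m1 u v = 0).
      { destruct (Rmult_integral _ _ (Z1 u v Duv)); auto. now destruct (q1nz u v Duv). }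
      split; auto.
      (* If q2 vanished here, so would nabla_1 k2 by Codazzi, and [m1] would reduce to nabla_1 k1
         k2^2, which is not 0. *)
      destruct (Rmult_integral _ _ (Z2 u v Duv)) as [E2|]; auto. exfalso.
      unfold m1 in E1. rewrite (Cod2 u v Duv), E2 in E1.
      destruct (hcanal u v Duv) as [_ [nd _]].
      apply (Rmult_integral_contrapositive (d1k1 u v) (k2 u v ^ 2)).
      - split; auto. apply pow_nonzero; auto.
      - lra. }
    destruct (connected_const_of_diff_0 D (fun a b => 1 / k1 a b + 1 / k2 a b))
      as [c Hc]; auto; try apply hx.
    { intros u v t Duv. rewrite dS by auto. destruct (Hm u v Duv) as [-> ->].
      apply div0; auto. ring. }
    split; [|now exists c]. now apply W_surface_of_sum_inv_const with c.
  - intros [_ [c Hc]].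
    assert (Hm : forall u v, D (u, v) -> m1 u v = 0 /\ m2 u v = 0).
    { intros u v Duv.
      assert (Z : forall t, m1 u v * omega x e1 u v t + m2 u v * omega x e2 u v t = 0).
      { intros t. pose proof (dS u v t Duv) as H.
        rewrite (diff_ext D _ (fun _ _ => c)), diff_const in H; auto.
        symmetry in H. apply div0 in H; auto. lra. }
      (* Evaluating the vanishing form on the dual vectors isolates [m1] and [m2]. *)
      destruct (coframe_surjective _ _ _ _ _ _ _ _ _ _ hx hframe u v 1 0 Duv) as [s [s1 s2]].
      destruct (coframe_surjective _ _ _ _ _ _ _ _ _ _ hx hframe u v 0 1 Duv) as [t [t1 t2]].
      pose proof (Z s) as Zs. pose proof (Z t) as Zt.
      rewrite s1, s2 in Zs. rewrite t1, t2 in Zt. split; lra. }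
    split; intros u v Duv.
    + rewrite Orth1 by auto. destruct (Hm u v Duv) as [-> _].
      apply div0; auto. ring.
    + rewrite Orth2 by auto. destruct (Hm u v Duv) as [_ ->].
      apply div0; auto. ring.
Qed.
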